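(* Let $\bm\alpha,\bm\beta\in\mathbb C^\ell$ with $\bm\alpha\neq0$ and $\bm\beta\neq0$, and let $d\in\mathbb C$. Then $L(d,\bm\alpha,\bm\beta)=W(\bm\alpha,\bm\beta)\big/\big\langle (I-d)\,\mathbb C[I]\,w_{\bm\alpha,\bm\beta}\big\rangle$ is an irreducible $\mathfrak{gl}(2\ell,\mathbb C)$-module, where $\langle S\rangle$ denotes the $\mathfrak{gl}(2\ell,\mathbb C)$-submodule generated by $S$.
   Context: $\mathcal A_{2\ell}$ is the complex Weyl algebra generated by $a_i,a_i^*$, $i=1,\dots,2\ell$, with $[a_i,a_j]=[a_i^*,a_j^*]=0$, $[a_i,a_j^*]=\delta_{i,j}$; normal ordering $:xy:=\tfrac12(xy+yx)$. For $\bm\alpha=(\alpha_1,\dots,\alpha_\ell)$, $\bm\beta=(\beta_1,\dots,\beta_\ell)\in\mathbb C^\ell$, $W(\bm\alpha,\bm\beta)=\mathcal A_{2\ell}/I_\ell(\bm\alpha,\bm\beta)$, where $I_\ell(\bm\alpha,\bm\beta)$ is the left ideal generated by $a_i-\alpha_i$ and $a^*_{\ell+i}-\beta_i$ ($i=1,\dots,\ell$); $w_{\bm\alpha,\bm\beta}$ is the image of $1$. $\mathfrak{gl}(2\ell,\mathbb C)$, with matrix units $e_{i,j}$, acts on $\mathcal A_{2\ell}$-modules through the Lie homomorphism $e_{i,j}\mapsto\,:a_ia_j^*:$. $I=\sum_{i=1}^{2\ell}:a_ia_i^*:$ is the action of the central element $\sum_{i=1}^{2\ell}e_{i,i}$,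 and $\mathbb C[I]w_{\bm\alpha,\bm\beta}=\operatorname{span}\{I^kw_{\bm\alpha,\bm\beta}:k\ge0\}$. *)

(* Defs.v *)
From HB Require Import structures.
From mathcomp Require Import all_boot all_order all_algebra.
From mathcomp Require Import mpoly.
From mathcomp Require Import complex.
From mathcomp Require Import reals.

Set Implicit Arguments.
Unset Strict Implicit.
Unset Printing Implicit Defensive.

Import GRing.Theory Num.Theory.
Local Open Scope ring_scope.
Local Open Scope complex_scope.

(* The Weyl algebra A_{2l} is realized by its standard faithful               *)
(* representation on the polynomial ring C[z_1, ..., z_{2l}]:                 *)
(*    a_i   |-> d/dz_i   (partial derivative)                                 *)
(*    a_i^* |-> multiplication by z_i                                         *)
(* so that [a_i, a_j^*] = delta_ij and all other commutators vanish.          *)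
(* Generator index i in {1..2l} is i : 'I_(l + l); index i (1 <= i <= l) is   *)
(* lshift l i and index l + i is rshift l i, for i : 'I_l.                    *)

Section Weyl.
Variables (R : realType) (l : nat).

Definition Cx := R[i].
Definition Pol := {mpoly Cx[l + l]}.
Definition Op := Pol -> Pol.

Definition wa (i : 'I_(l + l)) : Op := fun p => mderiv i p.
Definition was (i : 'I_(l + l)) : Op := fun p => 'X_i * p.
Definition wscal (c : Cx) : Op := fun p => c *: p.
Definition wadd (f g : Op) : Op := fun p => f p + g p.
Definition wcomp (f g : Op) : Op := fun p => f (g p).
Definition wzero : Op := fun _ => 0.
Definition wone : Op := fun p => p.

Inductive weyl : Op -> Prop :=
  | weyl_a i : weyl (wa i)
  | weyl_as i : weyl (was i)
  | weyl_scal c : weyl (wscal c)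
  | weyl_add f g : weyl f -> weyl g -> weyl (wadd f g)
  | weyl_comp f g : weyl f -> weyl g -> weyl (wcomp f g).

Definition normord (x y : Op) : Op :=
  wcomp (wscal (2%:R)^-1) (wadd (wcomp x y) (wcomp y x)).

(* action of the matrix unit e_{i,j} of gl(2l, C): e_{i,j} |-> :a_i a_j^*: *)
Definition glE (i j : 'I_(l + l)) : Op := normord (wa i) (was j).

Definition Iop : Op := fun p => \sum_(i < l + l) glE i i p.

Inductive Iideal (al be : 'I_l -> Cx) : Op -> Prop :=
  | Iideal_gen1 f i : weyl f ->
      Iideal al be (wcomp f (wadd (wa (lshift l i)) (wscal (- al i))))
  | Iideal_gen2 f i : weyl f ->
      Iideal al be (wcomp f (wadd (was (rshift l i)) (wscal (- be i))))
  | Iideal_zero : Iideal al be wzero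
  | Iideal_add f g : Iideal al be f -> Iideal al be g -> Iideal al be (wadd f g).

(* W(alpha, beta) = A_{2l} / I_l(alpha, beta), with w = image of 1.           *)
(* A gl(2l)-submodule of W is represented by its preimage V in A_{2l}:        *)
(* a subspace of A_{2l} containing I_l(alpha, beta) and stable under the      *)
(* left action of every e_{i,j}.                                              *)
Definition W_submodule (al be : 'I_l -> Cx) (V : Op -> Prop) : Prop :=
  [/\ (forall f, V f -> weyl f),
      (forall f, Iideal al be f -> V f),
      (forall f g, V f -> V g -> V (wadd f g)),
      (forall c f, V f -> V (wcomp (wscal c) f)) &
      (forall i j f, V f -> V (wcomp (glE i j) f))].

(* preimage in A_{2l} of the gl(2l)-submodule < (I - d) C[I] w > of W:       *)
(* generated by the classes of (I - d) I^k, k >= 0.                           *)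
Inductive Ngen (al be : 'I_l -> Cx) (d : Cx) : Op -> Prop :=
  | Ngen_ideal f : Iideal al be f -> Ngen al be d f
  | Ngen_gen k :
      Ngen al be d (wcomp (wadd Iop (wscal (- d))) (iter k (wcomp Iop) wone))
  | Ngen_add f g : Ngen al be d f -> Ngen al be d g -> Ngen al be d (wadd f g)
  | Ngen_scal c f : Ngen al be d f -> Ngen al be d (wcomp (wscal c) f)
  | Ngen_act i j f : Ngen al be d f -> Ngen al be d (wcomp (glE i j) f).

(* L(d, alpha, beta) = W / <(I - d) C[I] w> is an irreducible gl(2l)-module:  *)
(* it is nonzero, and (by the correspondence theorem) every gl(2l)-submodule  *)
(* of W containing <(I - d) C[I] w> equals it or equals W.                    *)
Definition L_irreducible (al be : 'I_l -> Cx) (d : Cx) : Prop :=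
  (exists f, weyl f /\ ~ Ngen al be d f) /\
  forall V, W_submodule al be V -> (forall f, Ngen al be d f -> V f) ->
    (forall f, V f -> Ngen al be d f) \/ (forall f, weyl f -> V f).

End Weyl.

(* Main.v *)
Require Import Defs.
From HB Require Import structures.
From mathcomp Require Import all_boot all_order all_algebra.
From mathcomp Require Import mpoly.
From mathcomp Require Import complex.
From mathcomp Require Import reals.
From mathcomp Require boolp.
From mathcomp Require Import ring.
Set Implicit Arguments.
Unset Strict Implicit.
Unset Printing Implicit Defensive.
Import GRing.Theory Num.Theory.
Local Open Scope ring_scope.

(* By the PBW theorem W(alpha, beta) is the polynomial ring C[x_1, ..., x_2l], where x_i
   stands for a_i^* (i <= l) or a_i (i > l), and the conjugate generators act as
   rho_i + d_i (i <= l) or rho_i - d_i (i > l), with rho = (alpha, beta).  Since alpha and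
   beta are nonzero, W is generated by w = 1 over gl(2l), and I commutes with gl(2l), so
   <(I - d) C[I] w> = (I - d) W.  The operator I - d has the linear form s = rho . x as
   principal symbol, so it raises degrees by exactly one; hence 1 is not in (I - d) W.
   If p of degree n > 0 lies in a submodule V containing (I - d) W but not w, the
   operators a_i a_j^* - rho_i rho_j (i <= l < j) lower the degree of p, so by induction
   they send p into (I - d) W.  Their principal symbols rho_j d_i - rho_i d_j thus kill
   the leading form of p modulo s; they span the derivations along the hyperplane s = 0,
   so that form is a multiple of s and p can be reduced modulo (I - d) W. *)

(** * Degree bounds, Euler's formula and derivatives of polynomials *)

Section PolynomialDegree.
Variables (F : numFieldType) (n : nat).
Implicit Types (p q : {mpoly F[n]}) (i : 'I_n) (c : F).

Lemma addmUBK i (m : 'X_{1..n}) : m i != 0%N -> (U_(i) + (m - U_(i)))%MM = m.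
Proof.
move=> mi; apply/mnmP => j; rewrite mnmDE mnmBE mnm1E.
by case: eqP => [<-|_]; rewrite ?subn0 // add1n subn1 prednK // lt0n.
Qed.

Lemma mnm_neq0P (m : 'X_{1..n}) : m != 0%MM -> exists i, m i != 0%N.
Proof.
move=> m0; apply/existsP; rewrite -negb_forall; apply: contra m0 => /forallP m0.
by apply/eqP/mnmP => i; rewrite mnm0E; apply/eqP.
Qed.

Lemma mpolyX_gen_ind (P : {mpoly F[n]} -> Prop) :
    P 1 -> (forall i p, P p -> P ('X_i * p)) -> forall m, P 'X_[m].
Proof.
move=> P1 PX m; move: {2}(mdeg m) (erefl (mdeg m)) => k.
elim: k m => [|k IH] m.
  by move/eqP; rewrite mdeg_eq0 => /eqP ->; rewrite mpolyX0.
move=> mk; have /mnm_neq0P[i mi] : m != 0%MM by rewrite -mdeg_eq0 mk.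
rewrite -(addmUBK mi) mpolyXD; apply/PX/IH; move: mk.
by rewrite -{1}(addmUBK mi) mdegD mdeg1 => -[].
Qed.

Lemma mpoly_gen_ind (P : {mpoly F[n]} -> Prop) :
    P 1 -> (forall p q, P p -> P q -> P (p + q)) ->
    (forall c p, P p -> P (c *: p)) -> (forall i p, P p -> P ('X_i * p)) ->
  forall p, P p.
Proof.
move=> P1 PD PZ PX; elim/mpolyind => [|c m p _ _ Pp].
  by rewrite -(scale0r (1 : {mpoly F[n]})); apply: PZ.
by apply: PD => //; apply: PZ; apply: mpolyX_gen_ind.
Qed.

Lemma mderivXU i j : ('X_j : {mpoly F[n]})^`M(i) = (i == j)%:R.
Proof.
rewrite mderivX mnm1E eq_sym; case: eqP => [->|_]; last by rewrite scale0r.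
rewrite scale1r -mpolyX0; congr 'X_[_].
by apply/mnmP => k; rewrite mnmBE subnn mnm0E.
Qed.

Lemma mderivXUM i j p : ('X_j * p)^`M(i) = (i == j)%:R *: p + 'X_j * p^`M(i).
Proof. by rewrite mderivM mderivXU scaler_nat mulr_natl. Qed.

Lemma msize_leP p k :
  reflect (forall m, (k <= mdeg m)%N -> p@_m = 0) (msize p <= k)%N.
Proof.
apply: (iffP idP) => [pk m km|p0].
  by apply: memN_msupp_eq0; apply: msize_mdeg_ge; apply: leq_trans km.
rewrite msizeE; apply/bigmax_leqP_seq => m; rewrite mcoeff_msupp => pm _.
by rewrite ltnNge; apply: contra pm => /p0 ->.
Qed.

Lemma msizeD_leq p q k : (msize p <= k)%N -> (msize q <= k)%N -> (msize (p + q)%R <= k)%N.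
Proof. by move=> pk qk; apply: leq_trans (msizeD_le _ _) _; rewrite geq_max pk. Qed.

Lemma msizeB_leq p q k : (msize p <= k)%N -> (msize q <= k)%N -> (msize (p - q)%R <= k)%N.
Proof. by move=> pk qk; apply: msizeD_leq => //; rewrite msizeN. Qed.

Lemma msizeZ_leq c p k : (msize p <= k)%N -> (msize (c *: p) <= k)%N.
Proof. exact/leq_trans/msizeZ_le. Qed.

Lemma msize_sum_leq (I : Type) (r : seq I) (P : pred I) (f : I -> {mpoly F[n]}) k :
  (forall x, P x -> (msize (f x) <= k)%N) ->
  (msize (\sum_(x <- r | P x) f x)%R <= k)%N.
Proof.
move=> fk; elim/big_ind: _ => //; first by rewrite msize0.
by move=> p q; apply: msizeD_leq.
Qed.

Lemma msize_mderiv_leq i p k : (msize p <= k.+1)%N -> (msize p^`M(i) <= k)%N.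
Proof.
move=> /msize_leP pk; apply/msize_leP => m km; rewrite mcoeff_deriv pk ?mul0rn //.
by rewrite mdegD mdeg1 addn1.
Qed.

Lemma msizeXM_leq i p k : (msize p <= k)%N -> (msize ('X_i * p) <= k.+1)%N.
Proof.
move=> pk; have [->|p0] := eqVneq p 0; first by rewrite mulr0 msize0.
rewrite msizeM ?msizeX ?mdeg1 //.
by rewrite -msize_poly_eq0 msizeX.
Qed.

Lemma msizeXM_mderiv_leq i j p k : (msize p <= k)%N -> (msize ('X_i * p^`M(j)) <= k)%N.
Proof.
case: k => [|k] pk; last by apply/msizeXM_leq/msize_mderiv_leq.
move: pk; rewrite leqn0 msize_poly_eq0 => /eqP ->.
by rewrite mderiv0 mulr0 msize0.
Qed.

Lemma mcoeff_XM_mderiv i p m : ('X_i * p^`M(i))@_m = p@_m *+ m i.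
Proof.
elim/mpolyind: p => [|c m' p _ _ IH].
  by rewrite mderiv0 mulr0 !mcoeff0 mul0rn.
rewrite mderivD mulrDr !mcoeffD IH mulrnDl; congr (_ + _).
rewrite mderivZ -scalerAr !mcoeffZ mderivX -scalerAr mcoeffZ -mpolyXD !mcoeffX -mulrnAr.
congr (_ * _).
(* Exponent subtraction is truncated: [U_(i)] can be removed and restored only if [m' i] is nonzero;
   otherwise both sides vanish. *)
have [m0|m0] := eqVneq (m' i) 0%N.
  by rewrite m0 mul0r; case: eqP => [<-|]; rewrite ?m0 ?mulr0n ?mul0rn.
by rewrite addmUBK //; case: eqP => [->|]; rewrite ?mulr1 ?mulr0 ?mul0rn.
Qed.

(** [msize] is the degree plus one. The Euler operator multiplies terms of degree k by k, so exactly
    the top ones cancel. *)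
Lemma euler_msize_leq p k : (msize p <= k.+1)%N ->
  (msize ((\sum_i 'X_i * p^`M(i)) - k%:R *: p)%R <= k)%N.
Proof.
move=> /msize_leP pk; apply/msize_leP => m; rewrite leq_eqVlt => /orP[/eqP ->|km].
  rewrite mcoeffB raddf_sum /= mcoeffZ (eq_bigr (fun i => p@_m *+ m i)).
    by rewrite sumrMnr -mdegE mulr_natl subrr.
  by move=> i _; rewrite mcoeff_XM_mderiv.
rewrite mcoeffB raddf_sum /= mcoeffZ pk // mulr0 subr0 big1 // => i _.
by rewrite mcoeff_XM_mderiv pk ?mul0rn.
Qed.

(** Descend along nonzero derivatives; in characteristic zero, once all of them vanish the
    polynomial is constant. *)
Lemma mderiv_closed_const (K : {mpoly F[n]} -> Prop) :
    (forall i p, K p -> K p^`M(i)) ->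
  forall p, K p -> p != 0 -> exists2 c, c != 0 & K c%:MP.
Proof.
move=> Kd p; move: {2}(msize p) (leqnn (msize p)) => k.
elim: k p => [|k IH] p pk Kp p0.
  by move: pk; rewrite leqn0 msize_poly_eq0 (negPf p0).
have [/forallP H|] := boolP [forall i, p^`M(i) == 0]; last first.
  move=> /forallPn [i di]; apply: (IH p^`M(i)) => //; last exact: Kd.
  exact: msize_mderiv_leq.
have pE : p = (p@_0)%:MP.
  apply/mpolyP => m; rewrite mcoeffC; have [->|/mnm_neq0P[i mi]] := eqVneq m 0%MM.
    by rewrite mulr1.
  have := mcoeff_XM_mderiv i p m; rewrite (eqP (H i)) mulr0 mcoeff0 mulr0 => /esym/eqP.
  by rewrite mulrn_eq0 (negPf mi) /= => /eqP.
exists p@_0; last by rewrite -pE.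
by rewrite -(@mpolyC_eq0 n) -pE.
Qed.

End PolynomialDegree.

(** * Linear extension from monomials *)

Fact mpoly_lock_key : unit. Proof. by []. Qed.

Section LinearExtension.
Variables (F : numFieldType) (n : nat) (V : lmodType F) (T : 'X_{1..n} -> V).

(* Locked, lest unification unfold sums over supports of polynomials. *)
Definition mlext : {mpoly F[n]} -> V :=
  locked_with mpoly_lock_key (fun p => \sum_(m <- msupp p) p@_m *: T m).

Lemma mlextE (p : {mpoly F[n]}) : mlext p = \sum_(m <- msupp p) p@_m *: T m.
Proof. by rewrite /mlext unlock. Qed.

(** Allows polynomials with different supports to be expanded over one common set of monomials. *)
Lemma mlextwE (p : {mpoly F[n]}) (s : seq 'X_{1..n}) :
  uniq s -> {subset msupp p <= s} -> mlext p = \sum_(m <- s) p@_m *: T m.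
Proof.
move=> us ps; rewrite mlextE [RHS](bigID (fun m => m \in msupp p)) /= [X in _ + X]big1 ?addr0.
  rewrite -[RHS]big_filter; apply: perm_big; apply: uniq_perm => [||m].
  - exact: msupp_uniq.
  - exact: filter_uniq.
  - by rewrite mem_filter; case: (boolP (m \in msupp p)) => //= /ps ->.
by move=> m /memN_msupp_eq0 ->; rewrite scale0r.
Qed.

Lemma mlext_is_linear : linear mlext.
Proof.
move=> c p q; pose s := undup (msupp p ++ msupp q).
have us : uniq s by apply: undup_uniq.
rewrite !(@mlextwE _ s) //.
- by rewrite scaler_sumr -big_split; apply: eq_bigr => m _;
    rewrite mcoeffD mcoeffZ scalerDl scalerA.
- by move=> m mq; rewrite mem_undup mem_cat mq orbT.
- by move=> m mp; rewrite mem_undup mem_cat mp.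
move=> m /msuppD_le; rewrite mem_undup !mem_cat => /orP[/msuppZ_le ->//|->].
by rewrite orbT.
Qed.

HB.instance Definition _ := GRing.isLinear.Build F {mpoly F[n]} V _ mlext mlext_is_linear.

Lemma mlextX m : mlext 'X_[m] = T m.
Proof. by rewrite mlextE msuppX big_seq1 mcoeffX eqxx scale1r. Qed.

End LinearExtension.

(** * Restriction of exponents to sets of variables *)

Section MonomialParts.
Variable n : nat.
Implicit Types (b : pred 'I_n) (m : 'X_{1..n}).

Definition mnm_part b m : 'X_{1..n} := [multinom if b i then m i else 0%N | i < n].

Lemma mnm_part0 b : mnm_part b 0%MM = 0%MM.
Proof. by apply/mnmP => i; rewrite !mnmE if_same. Qed.

Lemma mnm_partD b m1 m2 : mnm_part b (m1 + m2) = (mnm_part b m1 + mnm_part b m2)%MM.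
Proof. by apply/mnmP => i; rewrite !mnmE; case: ifP. Qed.

Lemma mnm_partU b i : mnm_part b U_(i) = if b i then U_(i)%MM else 0%MM.
Proof.
apply/mnmP => j; rewrite mnmE mnm1E.
case: (eqVneq i j) => [<-|ij]; first by case: ifP; rewrite ?mnm1E ?eqxx ?mnm0E.
by rewrite if_same; case: ifP; rewrite ?mnm1E ?mnm0E // (negPf ij).
Qed.

Definition mnm_left (m : 'X_{1..n + n}) : 'X_{1..n} := [multinom m (lshift n i) | i < n].
Definition mnm_right (m : 'X_{1..n + n}) : 'X_{1..n} := [multinom m (rshift n i) | i < n].

Lemma mnm_left0 : mnm_left 0%MM = 0%MM.
Proof. by apply/mnmP => j; rewrite !mnmE. Qed.
Lemma mnm_right0 : mnm_right 0%MM = 0%MM.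
Proof. by apply/mnmP => j; rewrite !mnmE. Qed.
Lemma mnm_leftDl i (m : 'X_{1..n + n}) : mnm_left (U_(lshift n i) + m) = (U_(i) + mnm_left m)%MM.
Proof. by apply/mnmP => j; rewrite !mnmE eq_lshift. Qed.
Lemma mnm_leftDr i (m : 'X_{1..n + n}) : mnm_left (U_(rshift n i) + m) = mnm_left m.
Proof. by apply/mnmP => j; rewrite !mnmE eq_rlshift. Qed.
Lemma mnm_rightDr i (m : 'X_{1..n + n}) : mnm_right (U_(rshift n i) + m) = (U_(i) + mnm_right m)%MM.
Proof. by apply/mnmP => j; rewrite !mnmE eq_rshift. Qed.
Lemma mnm_rightDl i (m : 'X_{1..n + n}) : mnm_right (U_(lshift n i) + m) = mnm_right m.
Proof. by apply/mnmP => j; rewrite !mnmE eq_lrshift. Qed.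

End MonomialParts.

Lemma mderiv_XM (F : numFieldType) (n : nat) i (m : 'X_{1..n}) (p : {mpoly F[n]}) :
  m i = 0%N -> ('X_[m] * p)^`M(i) = 'X_[m] * p^`M(i).
Proof. by move=> mi; rewrite mderivM mderivX mi scale0r mul0r add0r. Qed.

(** * Poincaré-Birkhoff-Witt normal form in the Weyl algebra *)

Section WeylNormalForm.
Variables (R : realType) (l : nat).
Local Notation n := (l + l)%N.
Local Notation Cx := (Cx R).
Local Notation Pol := (Pol R l).
Local Notation Op := (Op R l).
Local Notation Sym := {mpoly Cx[n + n]}.
Implicit Types (i j : 'I_n) (p q : Pol) (s t : Sym) (c : Cx).

Definition lower i : bool := (i < l)%N.

Lemma lower_lshift (i : 'I_l) : lower (lshift l i).
Proof. exact: (ltn_ord i). Qed.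

Lemma lower_rshift (i : 'I_l) : lower (rshift l i) = false.
Proof. by apply/negbTE; rewrite /lower -leqNgt leq_addr. Qed.

(* [agen i] is the generator that acts on w as a scalar (a_i for i <= l, a_i^* for i > l),
   [cgen i] its conjugate. *)
Definition cgen i : Op := if lower i then @was R l i else @wa R l i.
Definition agen i : Op := if lower i then @wa R l i else @was R l i.
(** The value of the commutator of [agen i] with [cgen i], in this order. *)
Definition wsign i : Cx := if lower i then 1 else -1.

Lemma wa_is_linear i : linear (@wa R l i).
Proof. by move=> c p q; rewrite /wa linearP. Qed.
Lemma was_is_linear i : linear (@was R l i).
Proof. by move=> c p q; rewrite /was mulrDr scalerAr. Qed.
Lemma cgen_is_linear i : linear (cgen i).
Proof. by rewrite /cgen; case: ifP => _; [apply: was_is_linear|apply: wa_is_linear]. Qed.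
Lemma agen_is_linear i : linear (agen i).
Proof. by rewrite /agen; case: ifP => _; [apply: wa_is_linear|apply: was_is_linear]. Qed.
HB.instance Definition _ i := GRing.isLinear.Build Cx Pol Pol _ (cgen i) (cgen_is_linear i).
HB.instance Definition _ i := GRing.isLinear.Build Cx Pol Pol _ (agen i) (agen_is_linear i).

Lemma agen_cgen i j p :
  agen i (cgen j p) = cgen j (agen i p) + ((i == j)%:R * wsign i) *: p.
Proof.
rewrite /agen /cgen /wsign /wa /was.
have [<-|ij] := eqVneq i j; rewrite ?mul0r ?scale0r ?addr0 ?mul1r.
  case: ifP => _; rewrite mderivXUM eqxx !scale1r addrC //.
  by rewrite scaleN1r addKr.
case: ifP => li; case: ifP => lj.
- by rewrite mderivXUM (negPf ij) scale0r add0r.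
- exact: mderiv_comm.
- exact: mulrCA.
- by rewrite mderivXUM eq_sym (negPf ij) scale0r add0r.
Qed.

(** Monomials in the [cgen]'s, and below in the [agen]'s. Within each family the multiplications and
    derivatives involve disjoint sets of variables, so the factors commute. *)
Definition cmon (m : 'X_{1..n}) : Op :=
  fun p => 'X_[mnm_part lower m] * p^`M[mnm_part (predC lower) m].
Definition amon (m : 'X_{1..n}) : Op :=
  fun p => ('X_[mnm_part (predC lower) m] * p)^`M[mnm_part lower m].

Lemma cmon_is_linear m : linear (cmon m).
Proof. by move=> c p q; rewrite /cmon linearP mulrDr scalerAr. Qed.
Lemma amon_is_linear m : linear (amon m).
Proof. by move=> c p q; rewrite /amon mulrDr -scalerAr linearP. Qed.
HB.instance Definition _ m := GRing.isLinear.Build Cx Pol Pol _ (cmon m) (cmon_is_linear m).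
HB.instance Definition _ m := GRing.isLinear.Build Cx Pol Pol _ (amon m) (amon_is_linear m).

Lemma cmon0 p : cmon 0%MM p = p.
Proof. by rewrite /cmon !mnm_part0 mderivm0m mpolyX0 mul1r. Qed.

Lemma amon0 p : amon 0%MM p = p.
Proof. by rewrite /amon !mnm_part0 mderivm0m mpolyX0 mul1r. Qed.

Lemma cmonU i m p : cmon (U_(i) + m)%MM p = cgen i (cmon m p).
Proof.
rewrite /cmon /cgen !mnm_partD !mnm_partU /=.
case: ifP => li /=; rewrite add0m.
  by rewrite mpolyXD -mulrA.
rewrite addmC mderivmDm mderivmU1m /wa mderiv_XM //.
by rewrite mnmE li.
Qed.

Lemma amonU i m p : amon (U_(i) + m)%MM p = amon m (agen i p).
Proof.
rewrite /amon /agen !mnm_partD !mnm_partU /=.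
case: ifP => li /=; rewrite add0m.
  by rewrite mderivmDm mderivmU1m mderiv_XM // mnmE /= li.
by rewrite addmC mpolyXD -mulrA.
Qed.

(* Mixed normal ordering: the [lshift] variables stand for the [cgen]'s, written on
   the left, the [rshift] variables for the [agen]'s, written on the right, so that
   right multiplication by the [agen]'s, on which the left ideal I is built, becomes
   plain multiplication of symbols. *)
Definition wquant s : Op :=
  fun p => mlext (fun m => cmon (mnm_left m) (amon (mnm_right m) p)) s.

Lemma wquant_linearl c s t p : wquant (c *: s + t) p = c *: wquant s p + wquant t p.
Proof. by rewrite /wquant linearP. Qed.

Lemma wquantX m p : wquant 'X_[m] p = cmon (mnm_left m) (amon (mnm_right m) p).
Proof. exact: mlextX. Qed.

Lemma wquant_is_linear s : linear (wquant s).
Proof.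
move=> c p q; rewrite /wquant !mlextE scaler_sumr -big_split; apply: eq_bigr => m _ /=.
by rewrite !linearP.
Qed.
HB.instance Definition _ s := GRing.isLinear.Build Cx Pol Pol _ (wquant s) (wquant_is_linear s).

Lemma wquant0 p : wquant 0 p = 0. Proof. exact: linear0. Qed.

Lemma wquantC c p : wquant c%:MP p = c *: p.
Proof.
rewrite -[c%:MP]mulr1 mul_mpolyC -mpolyX0 /wquant linearZ /= mlextX.
by rewrite mnm_left0 mnm_right0 cmon0 amon0.
Qed.

Lemma wquantD s t p : wquant (s + t) p = wquant s p + wquant t p.
Proof. exact: linearD. Qed.

Lemma wquantZ c s p : wquant (c *: s) p = c *: wquant s p.
Proof. exact: linearZ. Qed.

Lemma wquant_cgenl i s p : wquant ('X_(lshift n i) * s) p = cgen i (wquant s p).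
Proof.
elim/mpolyind: s => [|c m s _ _ IH]; first by rewrite mulr0 wquant0 linear0.
rewrite mulrDr -scalerAr wquant_linearl IH wquant_linearl linearP; congr (_ *: _ + _).
by rewrite -mpolyXD !wquantX mnm_leftDl mnm_rightDl cmonU.
Qed.

Lemma wquant_agenr i s p : wquant ('X_(rshift n i) * s) p = wquant s (agen i p).
Proof.
elim/mpolyind: s => [|c m s _ _ IH]; first by rewrite mulr0 !wquant0.
rewrite mulrDr -scalerAr wquant_linearl IH wquant_linearl; congr (_ *: _ + _).
by rewrite -mpolyXD !wquantX mnm_leftDr mnm_rightDr amonU.
Qed.

(** Moving [agen i] right past the [cgen] factors gives one commutator [wsign i] per factor
    [cgen i], which differentiates the symbol; [wquant_cgenr] is the mirror image. *)
Lemma wquant_agenl i s p :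
  agen i (wquant s p) =
  wquant ('X_(rshift n i) * s + wsign i *: s^`M(lshift n i)) p.
Proof.
elim/mpoly_gen_ind: s p => [|s t IHs IHt|c s IH|k s IH] p.
- by rewrite -mpolyC1 mderivC scaler0 addr0 wquant_agenr !wquantC !scale1r.
- by rewrite wquantD linearD /= IHs IHt -wquantD mulrDr mderivD scalerDr addrACA.
- by rewrite wquantZ linearZ /= IH -wquantZ scalerDr scalerAr mderivZ !scalerA (mulrC c).
case: (split_ordP k) => j ->; rewrite mderivXUM ?eq_lshift ?eq_lrshift.
  rewrite wquant_cgenl agen_cgen IH -wquant_cgenl -wquantZ -wquantD; congr (wquant _ p).
  by rewrite mulrDr scalerDr scalerA mulrCA -scalerAr -addrA (addrC (_ *: s)) (mulrC (wsign i)).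
rewrite wquant_agenr IH -wquant_agenr scale0r add0r; congr (wquant _ p).
by rewrite mulrDr -scalerAr mulrCA.
Qed.

Lemma wquant_cgenr i s p :
  wquant s (cgen i p) =
  wquant ('X_(lshift n i) * s + wsign i *: s^`M(rshift n i)) p.
Proof.
elim/mpoly_gen_ind: s p => [|s t IHs IHt|c s IH|k s IH] p.
- by rewrite -mpolyC1 mderivC scaler0 addr0 wquant_cgenl !wquantC !scale1r.
- by rewrite wquantD IHs IHt -wquantD mulrDr mderivD scalerDr addrACA.
- by rewrite wquantZ IH -wquantZ scalerDr scalerAr mderivZ !scalerA (mulrC c).
case: (split_ordP k) => j ->; rewrite mderivXUM ?eq_rshift ?eq_rlshift.
  rewrite wquant_cgenl IH -wquant_cgenl scale0r add0r; congr (wquant _ p).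
  by rewrite mulrDr -scalerAr mulrCA.
rewrite wquant_agenr agen_cgen linearD linearZ /= IH -wquant_agenr -wquantZ -wquantD.
congr (wquant _ p); rewrite mulrDr scalerDr scalerA mulrCA -scalerAr -addrA.
rewrite (addrC (_ *: s)) (eq_sym j); case: eqP => [->|]; last by rewrite mul0r mulr0 !scale0r.
by rewrite (mulrC true%:R).
Qed.

(* Commutators with the generators differentiate symbols, so a nonzero element of the
   kernel could be differentiated down to a nonzero scalar. *)
Lemma wquant_eq0 s : (forall p, wquant s p = 0) -> s = 0.
Proof.
move=> s0; apply/eqP/negP => /negP sn0.
have [||c c0 Kc] := @mderiv_closed_const _ _ (fun t => forall p, wquant t p = 0) _ s _ sn0.
- move=> k t t0 p; apply: (@scalerI _ _ (wsign (match split k with inl j => j | inr j => j end))).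
    by rewrite /wsign; case: ifP => _; rewrite ?oner_eq0 // oppr_eq0 oner_eq0.
  rewrite scaler0 -wquantZ; case: split_ordP => j ->.
    have := wquant_agenl j t p; rewrite t0 linear0 wquantD wquant_agenr t0 add0r.
    by move=> <-.
  have := wquant_cgenr j t p; rewrite t0 wquantD wquant_cgenl t0 linear0 add0r.
  by move=> <-.
- by [].
have := Kc 1; rewrite wquantC => /eqP; rewrite scaler_eq0 (negPf c0) /=.
by rewrite oner_eq0.
Qed.

Lemma wquant_inj s t : wquant s = wquant t -> s = t.
Proof.
move=> st; apply/eqP; rewrite -subr_eq0; apply/eqP/wquant_eq0 => p.
by rewrite wquantD -scaleN1r wquantZ st scaleN1r subrr.
Qed.

Lemma weyl_linear (f : Op) : weyl f -> linear f.
Proof.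
elim=> {f} [i|i|c|f g _ lf _ lg|f g _ lf _ lg] a p q.
- exact: wa_is_linear.
- exact: was_is_linear.
- by rewrite /wscal scalerDr !scalerA mulrC.
- by rewrite /wadd lf lg scalerDr addrACA.
- by rewrite /wcomp lg lf.
Qed.

Lemma weyl_cgen i : weyl (cgen i).
Proof. by rewrite /cgen; case: ifP => _; constructor. Qed.

Lemma weyl_agen i : weyl (agen i).
Proof. by rewrite /agen; case: ifP => _; constructor. Qed.

Lemma weyl_wquant s : weyl (wquant s).
Proof.
elim/mpoly_gen_ind: s => [|s t ws wt|c s ws|k s ws].
- have -> : wquant 1 = wscal 1 by apply: boolp.funext => p; rewrite -mpolyC1 wquantC.
  exact: weyl_scal.
- have -> : wquant (s + t) = wadd (wquant s) (wquant t).
    by apply: boolp.funext => p; rewrite wquantD.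
  exact: weyl_add.
- have -> : wquant (c *: s) = wcomp (wscal c) (wquant s).
    by apply: boolp.funext => p; rewrite wquantZ.
  by apply: weyl_comp => //; apply: weyl_scal.
case: (split_ordP k) => j ->.
  have -> : wquant ('X_(lshift n j) * s) = wcomp (cgen j) (wquant s).
    by apply: boolp.funext => p; rewrite wquant_cgenl.
  by apply: weyl_comp => //; apply: weyl_cgen.
have -> : wquant ('X_(rshift n j) * s) = wcomp (wquant s) (agen j).
  by apply: boolp.funext => p; rewrite wquant_agenr.
by apply: weyl_comp => //; apply: weyl_agen.
Qed.

Lemma weyl_wquant_ex (f : Op) : weyl f -> exists s, f = wquant s.
Proof.
(* With an arbitrary symbol [t] on the right, the claim passes through compositions without a
   formula for the product of symbols. *)
suff H : weyl f -> forall t, exists s, forall p, f (wquant t p) = wquant s p.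
  move=> /H/(_ 1)[s Hs]; exists s; apply: boolp.funext => p.
  by rewrite -Hs -mpolyC1 wquantC scale1r.
have Hc i t : exists s, forall p, cgen i (wquant t p) = wquant s p.
  by eexists => p; rewrite -wquant_cgenl.
have Ha i t : exists s, forall p, agen i (wquant t p) = wquant s p.
  by eexists => p; rewrite wquant_agenl.
elim=> {f} [i|i|c|f g _ Hf _ Hg|f g _ Hf _ Hg] t.
- by move: (Ha i t) (Hc i t); rewrite /agen /cgen; case: ifP.
- by move: (Ha i t) (Hc i t); rewrite /agen /cgen; case: ifP.
- by exists (c *: t) => p; rewrite wquantZ.
- have [s Hs] := Hf t; have [s' Hs'] := Hg t.
  by exists (s + s') => p; rewrite /wadd Hs Hs' wquantD.
- have [s Hs] := Hg t; have [s' Hs'] := Hf s.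
  by exists s' => p; rewrite /wcomp Hs Hs'.
Qed.

End WeylNormalForm.

(** * Scalar identities in modules *)

Lemma affine_comm (K : comNzRingType) (V : lmodType K) (a b u v : K)
    (D E : {linear V -> V}) (p : V) :
  D (E p) = E (D p) ->
  a *: (b *: p + v *: E p) + u *: D (b *: p + v *: E p) =
  b *: (a *: p + u *: D p) + v *: E (a *: p + u *: D p).
Proof.
move=> DE; rewrite !linearD /= ![D (_ *: _)]linearZ ![E (_ *: _)]linearZ /= !scalerA DE.
by rewrite (mulrC u b) (mulrC v a) (mulrC b a) (mulrC v u) addrACA.
Qed.

(** A Plücker relation: two minors sharing the pivot [a] determine the third. It serves to treat
    indices i > l in [psym_mod_euler]. *)
Lemma scale_eliminate (K : fieldType) (V : lmodType K) (a b c : K) (x y z : V) :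
  a != 0 ->
  a^-1 *: (c *: (b *: x - a *: z) + (- b) *: (c *: x - a *: y)) = b *: y - c *: z.
Proof.
move=> a0; apply: (canLR (scalerK a0)); rewrite scaleNr !scalerBr opprB addrC.
by rewrite !scalerA (mulrC c b) addrA subrK (mulrC b a) (mulrC c a).
Qed.

Lemma scale_expand (K : comNzRingType) (V : lmodType K) (a b : K) (x y z t : V) :
  b *: (a *: x + y) - (a *: z + t) + (- (a * b)) *: x = b *: y - a *: z - t.
Proof.
rewrite scalerDr scalerA scaleNr (mulrC a b) addrAC [_ *: x + _]addrC addrK.
by rewrite opprD addrA.
Qed.

(** * The module W(alpha, beta) as a polynomial ring *)

Section WhittakerModule.
Variables (R : realType) (l : nat) (al be : 'I_l -> Cx R).
Local Notation n := (l + l)%N.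
Local Notation Cx := (Cx R).
Local Notation Pol := (Pol R l).
Local Notation Op := (Op R l).
Local Notation Sym := {mpoly Cx[n + n]}.
Implicit Types (i j : 'I_n) (p q : Pol) (s t : Sym) (c d : Cx) (f g : Op).

(** The eigenvalue of [agen i] on w, called rho in the header. *)
Definition weig i : Cx := match split i with inl k => al k | inr k => be k end.

Lemma weig_lshift (i : 'I_l) : weig (lshift l i) = al i.
Proof. by rewrite /weig (unsplitK (inl i)). Qed.

Lemma weig_rshift (i : 'I_l) : weig (rshift l i) = be i.
Proof. by rewrite /weig (unsplitK (inr i)). Qed.

Definition wev_var (k : 'I_(n + n)) : Pol :=
  match split k with inl i => 'X_i | inr i => (weig i)%:MP end.
(** In normal order the [agen] factors act on w first, so they can be replaced by their eigenvalues,
    leaving a polynomial in the [cgen]'s. *)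
Definition wev : Sym -> Pol := locked_with mpoly_lock_key (mmap (@mpolyC n Cx) wev_var).
Definition wlift : Pol -> Sym :=
  locked_with mpoly_lock_key (mmap (@mpolyC (n + n) Cx) (fun i => 'X_(lshift n i))).

Lemma wevD s t : wev (s + t) = wev s + wev t.
Proof. by rewrite /wev unlock mmapD. Qed.
Lemma wevZ c s : wev (c *: s) = c *: wev s.
Proof. by rewrite /wev unlock mmapZ mul_mpolyC. Qed.
Lemma wev1 : wev 1 = 1. Proof. by rewrite /wev unlock rmorph1. Qed.
Lemma wev0 : wev 0 = 0. Proof. by rewrite /wev unlock mmap0. Qed.
Lemma wev_XlM i s : wev ('X_(lshift n i) * s) = 'X_i * wev s.
Proof.
by rewrite /wev unlock rmorphM /= mmapX mmap1U /wev_var (unsplitK (inl i)).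
Qed.
Lemma wev_XrM i s : wev ('X_(rshift n i) * s) = weig i *: wev s.
Proof.
rewrite /wev unlock rmorphM /= mmapX mmap1U /wev_var (unsplitK (inr i)).
by rewrite mul_mpolyC.
Qed.

Lemma wliftD p q : wlift (p + q) = wlift p + wlift q.
Proof. by rewrite /wlift unlock mmapD. Qed.
Lemma wliftZ c p : wlift (c *: p) = c *: wlift p.
Proof. by rewrite /wlift unlock mmapZ mul_mpolyC. Qed.
Lemma wlift1 : wlift 1 = 1. Proof. by rewrite /wlift unlock rmorph1. Qed.
Lemma wlift0 : wlift 0 = 0. Proof. by rewrite /wlift unlock mmap0. Qed.
Lemma wlift_XM i p : wlift ('X_i * p) = 'X_(lshift n i) * wlift p.
Proof. by rewrite /wlift unlock rmorphM /= mmapX mmap1U. Qed.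

Lemma wev_mderivl i s : wev s^`M(lshift n i) = (wev s)^`M(i).
Proof.
elim/mpoly_gen_ind: s => [|s t IHs IHt|c s IH|k s IH].
- by rewrite wev1 -!mpolyC1 !mderivC wev0.
- by rewrite mderivD !wevD mderivD IHs IHt.
- by rewrite mderivZ !wevZ mderivZ IH.
rewrite mderivXUM wevD wevZ; case: (split_ordP k) => j ->.
  by rewrite !wev_XlM IH eq_lshift mderivXUM.
by rewrite !wev_XrM IH eq_lrshift scale0r add0r mderivZ.
Qed.

Lemma Iideal_compl f g : weyl f -> Iideal al be g -> Iideal al be (wcomp f g).
Proof.
move=> wf; elim=> {g} [g i wg|g i wg||g h _ IHg _ IHh].
- exact: (Iideal_gen1 al be i (weyl_comp wf wg)).
- exact: (Iideal_gen2 al be i (weyl_comp wf wg)).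
- have -> : wcomp f (@wzero R l) = @wzero R l; last exact: Iideal_zero.
  apply: boolp.funext => p; rewrite /wcomp /wzero.
  by have := weyl_linear wf (-1) 0 0; rewrite scaler0 addr0 scaleN1r addNr.
- have -> : wcomp f (wadd g h) = wadd (wcomp f g) (wcomp f h); last exact: Iideal_add.
  apply: boolp.funext => p; rewrite /wcomp /wadd.
  by have := weyl_linear wf 1 (g p) (h p); rewrite !scale1r.
Qed.

Lemma Iideal_agen i f : weyl f ->
  Iideal al be (wcomp f (wadd (agen i) (wscal (- weig i)))).
Proof.
move=> wf; rewrite /agen; case: (split_ordP i) => j ->.
  by rewrite lower_lshift weig_lshift; apply: Iideal_gen1.
by rewrite lower_rshift weig_rshift; apply: Iideal_gen2.
Qed.

(** By induction, every symbol is congruent modulo the left ideal to its value under [wev], put back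
    among symbols by [wlift]. *)
Lemma Iideal_wquant s : wev s = 0 -> Iideal al be (wquant s).
Proof.
suff H : forall t, Iideal al be (wquant (t - wlift (wev t))).
  by move=> s0; have := H s; rewrite s0 wlift0 subr0.
move=> {s} t.
elim/mpoly_gen_ind: t => [|s t IHs IHt|c s IH|k s IH].
- rewrite wev1 wlift1 subrr; have -> : wquant (0 : Sym) = @wzero R l.
    by apply: boolp.funext => p; rewrite wquant0.
  exact: Iideal_zero.
- have -> : wquant (s + t - wlift (wev (s + t))) =
    wadd (wquant (s - wlift (wev s))) (wquant (t - wlift (wev t))).
    apply: boolp.funext => p; rewrite /wadd -wquantD; congr (wquant _ p).
    by rewrite wevD wliftD opprD addrACA.
  exact: Iideal_add.
- have -> : wquant (c *: s - wlift (wev (c *: s))) =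
    wcomp (wscal c) (wquant (s - wlift (wev s))).
    apply: boolp.funext => p; rewrite /wcomp /wscal -wquantZ; congr (wquant _ p).
    by rewrite wevZ wliftZ scalerBr.
  by apply: Iideal_compl => //; apply: weyl_scal.
case: (split_ordP k) => j ->.
  have -> : wquant ('X_(lshift n j) * s - wlift (wev ('X_(lshift n j) * s))) =
    wcomp (cgen j) (wquant (s - wlift (wev s))).
    apply: boolp.funext => p; rewrite /wcomp -wquant_cgenl; congr (wquant _ p).
    by rewrite wev_XlM wlift_XM mulrBr.
  by apply: Iideal_compl => //; apply: weyl_cgen.
(* The rightmost factor [agen j] is traded for the scalar [weig j] at the cost of an element of the
   ideal. *)
have -> : wquant ('X_(rshift n j) * s - wlift (wev ('X_(rshift n j) * s))) =
  wadd (wcomp (wquant s) (wadd (agen j) (wscal (- weig j))))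
       (wcomp (wscal (weig j)) (wquant (s - wlift (wev s)))).
  apply: boolp.funext => p; rewrite /wcomp /wadd /wscal linearD linearZ /=.
  rewrite -wquant_agenr -!wquantZ -!wquantD; congr (wquant _ p).
  by rewrite wev_XrM wliftZ scalerBr scaleNr addrA addrNK.
apply: Iideal_add; first by apply: Iideal_agen; apply: weyl_wquant.
by apply: Iideal_compl => //; apply: weyl_scal.
Qed.

(* [wclass f p]: the image of [f] in W(alpha, beta), identified with the polynomial
   ring in the [cgen]'s applied to the cyclic vector, is [p]. *)
Definition wclass f p := exists2 s, f = wquant s & wev s = p.

Lemma wclass_uniq f p q : wclass f p -> wclass f q -> p = q.
Proof. by move=> [s -> <-] [t /wquant_inj -> <-]. Qed.

Lemma wclass_total f : weyl f -> exists p, wclass f p.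
Proof. by case/weyl_wquant_ex => s ->; exists (wev s); exists s. Qed.

Lemma wclass_weyl f p : wclass f p -> weyl f.
Proof. by move=> [s -> _]; apply: weyl_wquant. Qed.

Lemma wclass_add f g p q : wclass f p -> wclass g q -> wclass (wadd f g) (p + q).
Proof.
move=> [s -> <-] [t -> <-]; exists (s + t); last by rewrite wevD.
by apply: boolp.funext => r; rewrite wquantD.
Qed.

Lemma wclass_scal c f p : wclass f p -> wclass (wcomp (wscal c) f) (c *: p).
Proof.
move=> [s -> <-]; exists (c *: s); last by rewrite wevZ.
by apply: boolp.funext => r; rewrite wquantZ.
Qed.

Lemma wclass_one : wclass (@wone R l) 1.
Proof.
exists 1; last exact: wev1.
by apply: boolp.funext => r; rewrite -mpolyC1 wquantC scale1r.
Qed.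

(** Left multiples of the ideal's generators have symbols with a factor that [wev] kills;
    [Iideal_wquant] is the other direction. With [wclass_uniq] and [wclass_total] this identifies W
    with the polynomial ring. *)
Lemma wclass_ideal f : wclass f 0 <-> Iideal al be f.
Proof.
split=> [[s -> /Iideal_wquant //]|].
have gen i g : weyl g -> wclass (wcomp g (wadd (agen i) (wscal (- weig i)))) 0.
  case/weyl_wquant_ex => s ->; exists ('X_(rshift n i) * s - weig i *: s).
    apply: boolp.funext => p; rewrite /wcomp /wadd /wscal linearD linearZ /=.
    by rewrite -wquant_agenr -scaleNr wquantD wquantZ.
  by rewrite wevD -scaleNr wevZ wev_XrM -scalerDl subrr scale0r.
elim=> {f} [f i wf|f i wf||f g _ Wf _ Wg].
- have := gen (lshift l i) f wf; by rewrite /agen weig_lshift lower_lshift.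
- have := gen (rshift l i) f wf; by rewrite /agen weig_rshift lower_rshift.
- by exists 0; [apply: boolp.funext => p; rewrite wquant0|rewrite wev0].
- by rewrite -[0]addr0; apply: wclass_add.
Qed.

(** * The action of gl(2l) on polynomials and the central operator I *)

Definition pcgen i p : Pol := 'X_i * p.
Definition pagen i p : Pol := weig i *: p + wsign R i *: p^`M(i).

Lemma wclass_cgen i f p : wclass f p -> wclass (wcomp (cgen i) f) (pcgen i p).
Proof.
move=> [s -> <-]; exists ('X_(lshift n i) * s); last by rewrite wev_XlM.
by apply: boolp.funext => r; rewrite wquant_cgenl.
Qed.

Lemma wclass_agen i f p : wclass f p -> wclass (wcomp (agen i) f) (pagen i p).
Proof.
move=> [s -> <-]; exists ('X_(rshift n i) * s + wsign R i *: s^`M(lshift n i)).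
  by apply: boolp.funext => r; rewrite -wquant_agenl.
by rewrite wevD wevZ wev_mderivl wev_XrM.
Qed.

Definition pwa i := if lower i then pagen i else pcgen i.
Definition pwas i := if lower i then pcgen i else pagen i.

Lemma wclass_wa i f p : wclass f p -> wclass (wcomp (@wa R l i) f) (pwa i p).
Proof.
move=> Wf; move: (wclass_cgen i Wf) (wclass_agen i Wf).
by rewrite /cgen /agen /pwa; case: ifP.
Qed.

Lemma wclass_was i f p : wclass f p -> wclass (wcomp (@was R l i) f) (pwas i p).
Proof.
move=> Wf; move: (wclass_cgen i Wf) (wclass_agen i Wf).
by rewrite /cgen /agen /pwas; case: ifP.
Qed.

Definition pgl i j p : Pol := 2%:R^-1 *: (pwa i (pwas j p) + pwas j (pwa i p)).
Definition pI p : Pol := \sum_i pgl i i p.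

Lemma wclass_gl i j f p : wclass f p -> wclass (wcomp (glE i j) f) (pgl i j p).
Proof.
move=> Wf; apply: wclass_scal; apply: wclass_add.
  exact/wclass_wa/wclass_was.
exact/wclass_was/wclass_wa.
Qed.

Lemma wclass_I f p : wclass f p -> wclass (wcomp (@Iop R l) f) (pI p).
Proof.
move=> Wf; rewrite /wcomp /Iop /pI.
elim: (index_enum _) => [|i r IH].
  rewrite big_nil; exists 0; last exact: wev0.
  by apply: boolp.funext => q; rewrite big_nil wquant0.
have -> : (fun q => \sum_(j <- i :: r) glE j j (f q)) =
    wadd (wcomp (glE i i) f) (fun q => \sum_(j <- r) glE j j (f q)).
  by apply: boolp.funext => q; rewrite big_cons.
by rewrite big_cons; apply: wclass_add => //; apply: wclass_gl.
Qed.

Lemma pcgen_is_linear i : linear (pcgen i).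
Proof. by move=> c p q; rewrite /pcgen mulrDr scalerAr. Qed.
Lemma pagen_is_linear i : linear (pagen i).
Proof.
move=> c p q; rewrite /pagen mderivD mderivZ !scalerDr !scalerA addrACA.
by rewrite (mulrC c) (mulrC c).
Qed.
Lemma pwa_is_linear i : linear (pwa i).
Proof. by rewrite /pwa; case: ifP => _; [apply: pagen_is_linear|apply: pcgen_is_linear]. Qed.
Lemma pwas_is_linear i : linear (pwas i).
Proof. by rewrite /pwas; case: ifP => _; [apply: pcgen_is_linear|apply: pagen_is_linear]. Qed.
HB.instance Definition _ i := GRing.isLinear.Build Cx Pol Pol _ (pwa i) (pwa_is_linear i).
HB.instance Definition _ i := GRing.isLinear.Build Cx Pol Pol _ (pwas i) (pwas_is_linear i).
Lemma pgl_is_linear i j : linear (pgl i j).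
Proof.
move=> c p q; rewrite /pgl !linearP /= addrACA -[c *: _ + c *: _]scalerDr.
by rewrite [LHS]scalerDr !scalerA mulrC.
Qed.
HB.instance Definition _ i j := GRing.isLinear.Build Cx Pol Pol _ (pgl i j) (pgl_is_linear i j).
Lemma pI_is_linear : linear pI.
Proof.
move=> c p q; rewrite /pI scaler_sumr -big_split; apply: eq_bigr => i _ /=.
by rewrite linearP.
Qed.
HB.instance Definition _ := GRing.isLinear.Build Cx Pol Pol _ pI pI_is_linear.

Lemma pagen_pcgen i j p :
  pagen i (pcgen j p) = pcgen j (pagen i p) + ((i == j)%:R * wsign R i) *: p.
Proof.
rewrite /pagen /pcgen mderivXUM scalerDr scalerA mulrDr -!scalerAr.
by rewrite (mulrC (i == j)%:R) -[RHS]addrA; congr (_ + _); apply: addrC.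
Qed.

Lemma pcgenC i j p : pcgen i (pcgen j p) = pcgen j (pcgen i p).
Proof. exact: mulrCA. Qed.

Lemma pagenC i j p : pagen i (pagen j p) = pagen j (pagen i p).
Proof.
exact: (@affine_comm _ _ _ _ _ _ (mderiv i) (mderiv j) p (mderiv_comm j i p)).
Qed.

Lemma pagen_pcgenC i j p :
  lower i != lower j -> pagen i (pcgen j p) = pcgen j (pagen i p).
Proof.
move=> lij; rewrite pagen_pcgen; case: eqP => [ij|_]; first by rewrite ij eqxx in lij.
by rewrite mul0r scale0r addr0.
Qed.

Lemma pwaC i j p : pwa i (pwa j p) = pwa j (pwa i p).
Proof.
rewrite /pwa; case li: (lower i); case lj: (lower j).
- exact: pagenC.
- by rewrite pagen_pcgenC ?li ?lj.
- by rewrite pagen_pcgenC ?li ?lj.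
- exact: pcgenC.
Qed.

Lemma pwasC i j p : pwas i (pwas j p) = pwas j (pwas i p).
Proof.
rewrite /pwas; case li: (lower i); case lj: (lower j).
- exact: pcgenC.
- by rewrite pagen_pcgenC ?li ?lj.
- by rewrite pagen_pcgenC ?li ?lj.
- exact: pagenC.
Qed.

Lemma pwa_pwas i j p : pwa i (pwas j p) = pwas j (pwa i p) + (i == j)%:R *: p.
Proof.
rewrite /pwa /pwas; case li: (lower i); case lj: (lower j).
- by rewrite pagen_pcgen /wsign li mulr1.
- by case: eqP => [ij|_]; [rewrite ij lj in li|rewrite scale0r addr0 pagenC].
- by case: eqP => [ij|_]; [rewrite ij lj in li|rewrite scale0r addr0 pcgenC].
- by rewrite pagen_pcgen /wsign lj eq_sym mulrN1 scaleNr addrNK.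
Qed.

Lemma pglE i j p : pgl i j p = pwas j (pwa i p) + (2%:R^-1 * (i == j)%:R) *: p.
Proof.
rewrite /pgl pwa_pwas addrAC scalerDr -scalerA; congr (_ + _).
rewrite scalerDr -scalerDl -[RHS]scale1r; congr (_ *: _).
by field.
Qed.

(** The number operator plus the constant l: each of the 2l normal orderings contributes 1/2. *)
Lemma pIE p : pI p = \sum_k pwas k (pwa k p) + (\sum_(k < n) 2%:R^-1) *: p.
Proof.
rewrite /pI scaler_suml -big_split; apply: eq_bigr => k _ /=.
by rewrite pglE eqxx mulr1.
Qed.

Lemma pI_pwa i p : pI (pwa i p) = pwa i (pI p) - pwa i p.
Proof.
rewrite !pIE linearD linearZ /= addrAC; congr (_ + _).
apply: (canRL (addrK _)); rewrite linear_sum /=.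
rewrite [RHS](eq_bigr (fun k => pwas k (pwa k (pwa i p)) + (i == k)%:R *: pwa k p)); last first.
  by move=> k _; rewrite pwa_pwas pwaC.
rewrite big_split /=; congr (_ + _).
rewrite (bigD1 i) //= eqxx scale1r big1 ?addr0 // => k ki.
by rewrite eq_sym (negPf ki) scale0r.
Qed.

Lemma pI_pwas i p : pI (pwas i p) = pwas i (pI p) + pwas i p.
Proof.
rewrite !pIE linearD linearZ /= addrAC; congr (_ + _); rewrite linear_sum /=.
rewrite (eq_bigr (fun k => pwas i (pwas k (pwa k p)) + (k == i)%:R *: pwas k p)); last first.
  by move=> k _; rewrite pwa_pwas linearD linearZ /= pwasC.
rewrite big_split /=; congr (_ + _).
rewrite (bigD1 i) //= eqxx scale1r big1 ?addr0 // => k ki.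
by rewrite (negPf ki) scale0r.
Qed.

(** Passing a_i and a_j^* shifts I by opposite units, which cancel in each product. *)
Lemma pI_pgl i j p : pI (pgl i j p) = pgl i j (pI p).
Proof.
rewrite /pgl linearZ linearD /= pI_pwa !pI_pwas pI_pwa.
by rewrite [pwa i (_ + _)]linearD [pwas j (_ - _)]linearB /= addrK subrK.
Qed.

(* Leading part of [pI]: the form s of the header. *)
Definition psym : Pol := \sum_k weig k *: 'X_k.

Lemma mcoeff_psymU i : psym@_U_(i) = weig i.
Proof.
rewrite /psym raddf_sum /= (bigD1 i) //= mcoeffZ mcoeffXU eqxx mulr1 big1 ?addr0 //.
by move=> k ki; rewrite mcoeffZ mcoeffXU (negPf ki) mulr0.
Qed.

Lemma psym_neq0 i : weig i != 0 -> psym != 0.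
Proof. by apply: contraNneq => s0; rewrite -mcoeff_psymU s0 mcoeff0. Qed.

(** Separates the degree-raising part of e_kk, whose sum over k is multiplication by [psym], from
    terms that do not raise the degree. *)
Lemma pgl_diag k p :
  pgl k k p = weig k *: 'X_k * p +
    (wsign R k *: ('X_k * p^`M(k)) + (2%:R^-1 * wsign R k) *: p).
Proof.
have XaE : weig k *: 'X_k * p + wsign R k *: ('X_k * p^`M(k)) = pcgen k (pagen k p).
  by rewrite /pcgen /pagen mulrDr -!scalerAr -scalerAl.
rewrite addrA XaE pglE eqxx mulr1 /pwas /pwa /wsign; case: ifP => lk; first by rewrite mulr1.
(* For k > l, reordering adds -1 to the 1/2 of the normal ordering. *)
rewrite pagen_pcgen eqxx mul1r /wsign lk -addrA -scalerDl; congr (_ + _ *: _).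
by field.
Qed.

Lemma pI_psym_leq p k : (msize p <= k)%N -> (msize (pI p - psym * p)%R <= k)%N.
Proof.
move=> pk; rewrite /pI /psym mulr_suml -sumrB; apply: msize_sum_leq => i _.
rewrite pgl_diag [X in msize X]addrC addKr.
by apply: msizeD_leq; apply: msizeZ_leq => //; apply: msizeXM_mderiv_leq.
Qed.

Definition pIsub d p : Pol := pI p - d *: p.

Lemma pIsub_is_linear d : linear (pIsub d).
Proof.
move=> c p q; rewrite /pIsub linearP /= scalerDr opprD addrACA scalerBr !scalerA.
by rewrite (mulrC d).
Qed.
HB.instance Definition _ d :=
  GRing.isLinear.Build Cx Pol Pol _ (pIsub d) (pIsub_is_linear d).

Lemma pIsub_pgl d i j p : pIsub d (pgl i j p) = pgl i j (pIsub d p).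
Proof. by rewrite /pIsub pI_pgl [RHS]linearB /= [pgl i j (d *: p)]linearZ. Qed.

Lemma pIsub_psym_leq d p k :
  (msize p <= k)%N -> (msize (pIsub d p - psym * p)%R <= k)%N.
Proof.
move=> pk; rewrite /pIsub addrAC; apply: msizeB_leq; first exact: pI_psym_leq.
exact: msizeZ_leq.
Qed.

(** Polynomials form a domain and [psym] has degree one, so the degree of [psym * p] exceeds that of
    [p]; the other terms of I - d are too small to cancel it. *)
Lemma pIsub_msize_gt d i p : weig i != 0 -> p != 0 -> (msize p < msize (pIsub d p))%N.
Proof.
move=> ri p0; rewrite ltnNge; apply/negP => pk.
have : (msize (psym * p) <= msize p)%N.
  by rewrite -[psym * p](subKr (pIsub d p)); apply: msizeB_leq => //; apply: pIsub_psym_leq.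
rewrite msizeM ?(psym_neq0 ri) //.
have : (1 < msize psym)%N.
  by rewrite -(mdeg1 i); apply: msize_mdeg_lt; rewrite mcoeff_msupp mcoeff_psymU.
by case: (msize psym) => [//|[//|k]] _; rewrite addSn /= addSn ltnNge leq_addl.
Qed.

Lemma pIsub_neq1 d i p : weig i != 0 -> pIsub d p != 1.
Proof.
move=> ri; apply/eqP => p1; have [p0|p0] := eqVneq p 0.
  by move/eqP: p1; rewrite p0 linear0 eq_sym oner_eq0.
have := pIsub_msize_gt d ri p0; rewrite p1 msize1 ltnS leqn0 msize_poly_eq0.
by rewrite (negPf p0).
Qed.

(** Centrality of I carries the form (I - d) q through the action, so the generated submodule lies
    in (I - d) W. The reverse inclusion is [NJ] in the final proof. *)
Lemma wclass_Ngen d f : Ngen al be d f -> exists q, wclass f (pIsub d q).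
Proof.
elim=> {f} [f If|k|f g _ [p Wp] _ [q Wq]|c f _ [p Wp]|i j f _ [p Wp]].
- by exists 0; rewrite linear0; apply/wclass_ideal.
- have [q Wq] : exists q, wclass (iter k (wcomp (@Iop R l)) (@wone R l)) q.
    elim: k => [|k [q Wq]]; first by exists 1; apply: wclass_one.
    by exists (pI q); apply: wclass_I.
  exists q; rewrite /pIsub -scaleNr.
  exact: wclass_add (wclass_I Wq) (wclass_scal _ Wq).
- by exists (p + q); rewrite linearD; apply: wclass_add.
- by exists (c *: p); rewrite linearZ; apply: wclass_scal.
- by exists (pgl i j p); rewrite pIsub_pgl; apply: wclass_gl.
Qed.

(** * Cyclicity of W and maximality of (I - d) W *)

Record pgl_submodule (Q : Pol -> Prop) : Prop := PglSubmodule {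
  pgl_submodD : forall p q, Q p -> Q q -> Q (p + q);
  pgl_submodZ : forall c p, Q p -> Q (c *: p);
  pgl_submod_gl : forall i j p, Q p -> Q (pgl i j p) }.

Section Irreducibility.
Variables (i0 k0 : 'I_n).
Hypotheses (li0 : lower i0) (lk0 : lower k0 = false).
Hypotheses (ri0 : weig i0 != 0) (rk0 : weig k0 != 0).

(** Raising operators with leading part [weig r] times ['X_k]. A matrix unit pairs one a with one
    a^*, so [r] must lie in the same half of the indices as [k]: a nonzero entry is used from each
    of alpha and beta. *)
Lemma pgl_pcgen_pagen k : exists r a b c, weig r != 0 /\
  forall p, pgl a b p = pcgen k (pagen r p) + c *: p.
Proof.
case lk: (lower k).
  exists i0, i0, k, (2%:R^-1 * (i0 == k)%:R); split=> // p.
  by rewrite pglE /pwas /pwa li0 lk.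
exists k0, k, k0, ((k0 == k)%:R * wsign R k0 + 2%:R^-1 * (k == k0)%:R); split=> // p.
by rewrite pglE /pwas /pwa lk0 lk pagen_pcgen scalerDl addrA.
Qed.

(** Induction on the degree: a raising operator multiplies a monomial by ['X_j], up to a nonzero
    factor and terms of no larger degree than that monomial, already in [Q]. *)
Lemma pgl_cyclic Q : pgl_submodule Q -> Q 1 -> forall p, Q p.
Proof.
move=> [QD QZ Qgl] Q1.
have Q0 : Q 0 by rewrite -(scale0r (1 : Pol)); apply: QZ.
suff QX : forall k m, (mdeg m <= k)%N -> Q 'X_[m].
  elim/mpolyind => // c m p _ _ Qp; apply: (QD) => //; apply: QZ.
  exact: QX (leqnn _).
elim=> [|k IH] m.
  by rewrite leqn0 mdeg_eq0 => /eqP ->; rewrite mpolyX0.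
have [->|/mnm_neq0P[j mj]] := eqVneq m 0%MM; first by rewrite mpolyX0.
rewrite -(addmUBK mj) mdegD mdeg1 add1n ltnS mpolyXD; move: (m - _)%MM => m' mk.
have [r [a [b [c [rr pglr]]]]] := pgl_pcgen_pagen j.
have := pglr 'X_[m']; rewrite /pcgen /pagen mulrDr -!scalerAr => E.
have -> : 'X_j * 'X_[m'] = (weig r)^-1 *: (pgl a b 'X_[m'] +
    (- c) *: 'X_[m'] + (- wsign R r) *: ('X_j * 'X_[m']^`M(r))).
  by rewrite E !scaleNr addrK addrK scalerA mulVf // scale1r.
apply: (QZ); apply: (QD); first apply: (QD).
- exact/Qgl/IH.
- exact/QZ/IH.
apply: (QZ); rewrite mderivX -scalerAr; have [->|mr] := eqVneq (m' r) 0%N.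
  by rewrite scale0r.
apply: QZ; rewrite -mpolyXD; apply: IH; apply: leq_trans mk.
by rewrite -{2}(addmUBK mr) !mdegD !mdeg1.
Qed.

(* [p] is a multiple of [psym] up to terms of degree less than [k]. *)
Definition psym_mod k p := exists2 q, (msize q <= k)%N & (msize (p - psym * q)%R <= k)%N.

Lemma psym_modD k p q : psym_mod k p -> psym_mod k q -> psym_mod k (p + q).
Proof.
move=> [p' p'k pk] [q' q'k qk]; exists (p' + q'); first exact: msizeD_leq.
by rewrite mulrDr opprD addrACA; apply: msizeD_leq.
Qed.

Lemma psym_modZ k c p : psym_mod k p -> psym_mod k (c *: p).
Proof.
move=> [p' p'k pk]; exists (c *: p'); first exact: msizeZ_leq.
by rewrite -scalerAr -scalerBr; apply: msizeZ_leq.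
Qed.

Lemma psym_modXM k i p : psym_mod k p -> psym_mod k.+1 ('X_i * p).
Proof.
move=> [p' p'k pk]; exists ('X_i * p'); first exact: msizeXM_leq.
by rewrite mulrCA -mulrBr; apply: msizeXM_leq.
Qed.

Lemma psym_mod_psym k q : (msize q <= k)%N -> psym_mod k (psym * q).
Proof. by exists q; rewrite ?subrr ?msize0. Qed.

Lemma psym_mod_leq k p : (msize p <= k)%N -> psym_mod k p.
Proof. by exists 0; rewrite ?mulr0 ?subr0 ?msize0. Qed.

Lemma psym_modDr k p q : psym_mod k q -> psym_mod k (p + q) -> psym_mod k p.
Proof.
move=> Mq Mpq; rewrite -(addrK q p) -scaleN1r; apply: psym_modD => //.
exact: psym_modZ.
Qed.

(* To leading order: a form killed modulo [psym] by the fields [weig j d_i - weig i d_j],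
   i <= l < j, is killed by every derivation of the hyperplane [psym = 0], hence, by
   Euler's formula, is a multiple of [psym]. *)
Lemma psym_mod_euler k p : (msize p <= k.+2)%N ->
  (forall i j, lower i -> lower j = false ->
     psym_mod k (weig j *: p^`M(i) - weig i *: p^`M(j))) ->
  psym_mod k.+1 p.
Proof.
move=> pk Hp.
have Hi i : psym_mod k (weig k0 *: p^`M(i) - weig i *: p^`M(k0)).
  case li: (lower i); first exact: Hp.
  (* For i > l, the derivative in [i0] is eliminated between two of the given fields. *)
  have := psym_modD (psym_modZ (weig i) (Hp i0 k0 li0 lk0))
    (psym_modZ (- weig k0) (Hp i0 i li0 li)).
  by move=> /(psym_modZ (weig i0)^-1); rewrite (scale_eliminate _ _ _ _ _ ri0).
(* Contracting the fields of [Hi] with the variables produces the Euler operator and a multiple of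
   [psym]. *)
have HE : psym_mod k.+1 (weig k0 *: (\sum_i 'X_i * p^`M(i)) - psym * p^`M(k0)).
  rewrite scaler_sumr /psym mulr_suml -sumrB; elim/big_ind: _ => [||i _].
  - by apply: psym_mod_leq; rewrite msize0.
  - by move=> q q'; apply: psym_modD.
  by rewrite -scalerAl !scalerAr -mulrBr; apply/psym_modXM/Hi.
have {}HE : psym_mod k.+1 (weig k0 *: (\sum_i 'X_i * p^`M(i))).
  apply: psym_modDr HE; rewrite -mulrN; apply: psym_mod_psym.
  by rewrite msizeN; apply: msize_mderiv_leq.
have nz : weig k0 * k.+1%:R != 0 by rewrite mulf_neq0 // pnatr_eq0.
rewrite -[p]scale1r -(mulVf nz) -scalerA; apply: psym_modZ.
have := euler_msize_leq pk => /(msizeZ_leq (- weig k0))/psym_mod_leq/(psym_modD HE).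
by congr psym_mod; rewrite scaleNr scalerBr opprB addrCA subrr addr0 scalerA.
Qed.

Lemma pIsub_maximal d Q : pgl_submodule Q -> (forall q, Q (pIsub d q)) -> ~ Q 1 ->
  forall p, Q p -> exists q, p = pIsub d q.
Proof.
move=> [QD QZ Qgl] QJ Q1 p; move: {2}(msize p) (leqnn (msize p)) => k.
elim: k p => [|[|k] IH] p pk Qp.
- by exists 0; rewrite linear0; apply/eqP; rewrite -msize_poly_eq0 -leqn0.
(* A nonzero constant in [Q] would rescale to 1. *)
- move: (Qp); rewrite (msize1_polyC pk); have [->|c0] := eqVneq p@_0 0.
    by move=> _; exists 0; rewrite linear0 mpolyC0.
  move=> /(QZ (p@_0)^-1); rewrite -mul_mpolyC -mpolyCM mulVf // mpolyC1 => /Q1 [].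
have [g gk pg] : psym_mod k.+1 p.
  apply: psym_mod_euler => // i j li lj.
  (* The Whittaker operator a_i a_j^* - alpha_i beta_(j-l), which lowers the degree. *)
  pose D := pgl i j p + (- (weig i * weig j)) *: p.
  have DE : D = weig j *: p^`M(i) - weig i *: p^`M(j) - p^`M(i)^`M(j).
    rewrite /D pglE /pwa /pwas li lj; case: eqP => [ij|_]; first by rewrite ij lj in li.
    rewrite mulr0 scale0r addr0 /pagen /wsign li lj !scale1r !scaleN1r mderivD mderivZ.
    exact: scale_expand.
  have Dk : (msize (p^`M(i)^`M(j)) <= k)%N.
    by apply: msize_mderiv_leq; apply: msize_mderiv_leq.
  have D1 : (msize D <= k.+1)%N.
    rewrite DE; apply: msizeB_leq; last exact: leqW.
    by apply: msizeB_leq; apply: msizeZ_leq; apply: msize_mderiv_leq.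
  have QDD : Q D by apply: (QD); [apply: Qgl|apply: QZ].
  have [q Dq] := IH D D1 QDD.
  (* As I - d strictly raises degrees, [q] is smaller than [D], so [psym_mod k] ignores the
     difference between (I - d) q and [psym * q]. *)
  have qk : (msize q <= k)%N.
    have [->|q0] := eqVneq q 0; first by rewrite msize0.
    by rewrite -ltnS; apply: leq_trans D1; rewrite Dq; apply: (pIsub_msize_gt _ ri0).
  apply: (psym_modDr (q := - p^`M(i)^`M(j))); first by apply: psym_mod_leq; rewrite msizeN.
  rewrite -DE Dq; exists q => //; exact: pIsub_psym_leq.
(* Subtracting (I - d) g cancels the leading form of [p] without leaving [Q]. *)
have [||q pq] := IH (p - pIsub d g).
- rewrite -(subrK (psym * g) p) -addrA; apply: msizeD_leq => //.
  by rewrite -opprB msizeN; apply: pIsub_psym_leq.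
- by apply: (QD) => //; rewrite -scaleN1r; apply: QZ.
by exists (q + g); rewrite linearD /= -pq subrK.
Qed.

End Irreducibility.
End WhittakerModule.

(** * Return from polynomials to operators *)

Theorem theorem9p2 (R : realType) (l : nat) (al be : 'I_l -> Cx R) (d : Cx R) :
  (exists i, al i != 0) -> (exists i, be i != 0) ->
  L_irreducible al be d.
Proof.
move=> [i ali] [k bek].
have li := lower_lshift i; have lk := lower_rshift k.
have ri : weig al be (lshift l i) != 0 by rewrite weig_lshift.
have rk : weig al be (rshift l k) != 0 by rewrite weig_rshift.
(* A submodule contains the ideal, so membership depends only on the class in W. *)
have subI (V : Op R l -> Prop) f g p : W_submodule al be V ->
    wclass al be f p -> wclass al be g p -> V f -> V g.
  move=> [_ VI VD _ _] Wf Wg Vf.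
  have -> : g = wadd f (wadd g (wcomp (wscal (-1)) f)).
    by apply: boolp.funext => q; rewrite /wadd /wcomp /wscal scaleN1r addrC subrK.
  apply: VD => //; apply/VI/wclass_ideal.
  by have := wclass_add Wg (wclass_scal (-1) Wf); rewrite scaleN1r subrr.
pose img (V : Op R l -> Prop) p := exists2 f, V f & wclass al be f p.
have img_pgl V : W_submodule al be V -> pgl_submodule al be (img V).
  move=> [_ _ VD VZ Vgl]; split.
  - move=> p q [f Vf Wf] [g Vg Wg].
    by exists (wadd f g); [apply: VD|apply: wclass_add].
  - by move=> c p [f Vf Wf]; exists (wcomp (wscal c) f); [apply: VZ|apply: wclass_scal].
  - by move=> a b p [f Vf Wf]; exists (wcomp (glE a b) f); [apply: Vgl|apply: wclass_gl].
have Nweyl f : Ngen al be d f -> weyl f.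
  by case/wclass_Ngen => q /wclass_weyl.
have Nsub : W_submodule al be (Ngen al be d).
  split=> //; [exact: Ngen_ideal|exact: Ngen_add|exact: Ngen_scal|exact: Ngen_act].
(* By centrality of I, the q with (I - d) q in the image of [Ngen] form a submodule; it contains 1
   thanks to the generator with k = 0, so cyclicity applies. *)
have NJ q : img (Ngen al be d) (pIsub al be d q).
  apply: (pgl_cyclic li lk ri rk (Q := fun q => img (Ngen al be d) (pIsub al be d q))).
    have [ND NZ Ngl] := img_pgl _ Nsub; split=> [p p'|c p|a b p].
    - by rewrite linearD; apply: ND.
    - by rewrite linearZ; apply: NZ.
    - by rewrite pIsub_pgl; apply: Ngl.
  exists (wcomp (wadd (@Iop R l) (wscal (- d))) (@wone R l)).
    exact: (Ngen_gen al be d 0).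
  rewrite /pIsub -scaleNr.
  by apply: wclass_add; [apply: wclass_I|apply: wclass_scal]; apply: wclass_one.
split.
  exists (@wone R l); split; first exact: wclass_weyl (wclass_one al be).
  case/wclass_Ngen => q /wclass_uniq/(_ (wclass_one al be))/eqP.
  by rewrite (negPf (pIsub_neq1 _ _ ri)).
(* Either V contains w and is everything by cyclicity, or [pIsub_maximal] confines it to (I - d)
   W. *)
move=> V Vsub NV; have [img1|img1] := boolp.pselect (img V 1).
  right=> f /(wclass_total al be)[p Wf].
  have [g Vg Wg] := pgl_cyclic li lk ri rk (img_pgl V Vsub) img1 p.
  exact: subI Vsub Wg Wf Vg.
left=> f Vf; have [Vweyl _ _ _ _] := Vsub.
have [p Wf] := wclass_total al be (Vweyl f Vf).
have imgJ q : img V (pIsub al be d q) by have [g /NV] := NJ q; exists g.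
have [q pq] := pIsub_maximal li lk ri rk (img_pgl V Vsub) imgJ img1
  (ex_intro2 _ _ f Vf Wf).
have [g Ng Wg] := NJ q; rewrite -pq in Wg.
exact: subI Nsub Wg Wf Ng.
Qed.
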